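(* Let $p=2n+1\equiv 3\pmod 4$ be a prime. Let $\chi$ be a generator of the group of multiplicative characters of $\mathbb{F}_p$, let $$R_p=\prod_{0<k<(p-1)/4}\left(J_p(\phi_p,\chi^k)+J_p(\phi_p,\chi^{-k})\right)$$ (product over integers $k$), and let $A_p=\left[\phi_p(s_i+s_j)\right]_{1\le i,j\le (p-1)/2}$, where $s_1,\dots,s_{(p-1)/2}$ are all the nonzero squares of $\mathbb{F}_p$. Then $$R_p=\delta_p\cdot\sqrt{-2^{n-1}\det A_p},$$ where $\delta_p\in\{\pm1\}$ is such that $$\left(\frac{-2\delta_p\cdot\sqrt{-2^{n-1}\det A_p}}{p}\right)=1.$$
   Context: $\left(\frac{\cdot}{p}\right)$ is the Legendre symbol, and $\sqrt{\cdot}$ is the nonnegative real square root (here its value is an integer). Multiplicative characters of $\mathbb{F}_p$ are homomorphisms $\psi:\mathbb{F}_p^\times\to\mathbb{C}^\times$, forming a cyclic group of order $p-1$, and every one of them (including the trivial one) is extended by $\psi(0)=0$. $\phi_p$ is the unique quadratic multiplicative character of $\mathbb{F}_p$ (the Legendre symbol, with $\phi_p(0)=0$). For multiplicative characters $\chi,\psi$, the Jacobi sum is $J_p(\chi,\psi)=\sum_{x\in\mathbb{F}_p}\chi(x)\psi(1-x)$. The number $R_p$ is a rational integer independent of the choice of the generator $\chi$. An empty product equals $1$. $A_p$ is regarded as an integer matrix. *)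

(* Defs.v *)
From HB Require Import structures.
From mathcomp Require Import all_boot all_order all_algebra.
From mathcomp Require Import reals complex.
Set Implicit Arguments.
Unset Strict Implicit.
Unset Printing Implicit Defensive.
Import Order.TTheory GRing.Theory Num.Theory.
Local Open Scope ring_scope.

(* All definitions over 'F_p are meaningful only for p prime. *)

Definition nonzero_square (p : nat) (x : 'F_p) : bool :=
  (x != 0) && [exists y : 'F_p, x == y ^+ 2].

Definition quad_char (p : nat) (x : 'F_p) : int :=
  if x == 0 then 0 else if nonzero_square x then 1 else -1.

Definition legendre (p : nat) (a : int) : int := quad_char (a%:~R : 'F_p).

Section Characters.
Variables (p : nat) (C : fieldType).
Implicit Types chi psi : 'F_p -> C.

(* A homomorphism from the units of 'F_p to those of C, extended by 0 at 0:
   psi 1 = 1 and multiplicativity force psi x != 0 for x != 0. *)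
Definition mult_char psi : Prop :=
  [/\ psi 0 = 0, psi 1 = 1 & forall x y, psi (x * y) = psi x * psi y].

(* Power in the group of characters; the test matters for k = 0, as 0 ^ 0 = 1
   whereas the trivial character also vanishes at 0. *)
Definition char_exp chi (k : int) : 'F_p -> C :=
  fun x => if x == 0 then 0 else chi x ^ k.

Definition char_generator chi : Prop :=
  mult_char chi /\
  forall psi, mult_char psi -> exists k : int, psi =1 char_exp chi k.

Definition jacobi_sum chi psi : C := \sum_(x : 'F_p) chi x * psi (1 - x).

Definition phi : 'F_p -> C := fun x => (quad_char x)%:~R.

(* 0 < k < (p - 1) / 4, with the rational bound cleared of its denominator. *)
Definition Rp chi : C :=
  \prod_(0 <= k < p | (0 < k)%N && (4 * k < p - 1)%N)
     (jacobi_sum phi (char_exp chi k%:Z) + jacobi_sum phi (char_exp chi (- k%:Z))).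

End Characters.

Definition enumerates_squares (p n : nat) (s : 'I_n -> 'F_p) : Prop :=
  injective s /\ forall x : 'F_p, nonzero_square x <-> exists i, s i = x.

Definition Ap (p n : nat) (s : 'I_n -> 'F_p) : 'M[int]_n :=
  \matrix_(i < n, j < n) quad_char (s i + s j).

(* Main.v *)
Require Import Defs.
From mathcomp Require Import all_boot all_order all_algebra.
From mathcomp Require Import cyclic separable cyclotomic finfield.
From mathcomp Require Import reals complex.
From mathcomp Require Import ring zify.
Set Implicit Arguments.
Unset Strict Implicit.
Unset Printing Implicit Defensive.
Import Order.TTheory GRing.Theory Num.Theory.
Local Open Scope ring_scope.

(* Write n = 2m + 1, let G = <g> be the group of nonzero squares and, for a
   character psi of G in a field K, put
     L(psi) = \sum_(x in G) phi(1 + x) psi(x) = L(psi^-1).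
   Since phi(s_i + s_j) = phi(1 + s_j / s_i), the matrix A_p is a group matrix of
   G, with eigenvalues L(psi); pairing psi with psi^-1 and using L(1) = -1 gives
   det A_p = - (\prod_(1 <= k <= m) L(chi^k))^2.  A substitution in the Jacobi
   sums gives 2 L(psi) = psi(-1) (J(phi, psi) + J(phi, psi^-1)), so that R_p is
   2^m \prod_k L(chi^k) up to an explicit sign.

   The functions on G which are odd under x -> x^-1 form an invariant subspace,
   on which A_p acts by an integer m x m matrix (half_matrix); its determinant is
   \prod_(1 <= k <= m) L(psi^k) for any psi of order n, over any field where 2n is
   invertible.  With psi = chi over the complex numbers, this shows that R_p is an
   integer.  With psi the identity of 'F_p, it computes R_p mod p, without any
   prime ideal: 2 L(x^k) = - 'C(n, k), and 'C(n, k) is (-1)^k (2k)! up to a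
   square.  It remains to see that \prod_(1 <= k <= m) (2k)! is a square mod p,
   which follows from the vanishing of the sum of (t/p) over the t <= n of the
   same parity as m. *)

(** * Squares and the quadratic character of ['F_p] *)

Section QuadChar.
Variables (p n : nat).
Hypotheses (p_prime : prime p) (p_eq : p = (2 * n + 1)%N).

Lemma halfp_gt0 : (0 < n)%N.
Proof. by have := prime_gt1 p_prime; lia. Qed.

Lemma natrFp_eq0 k : ((k%:R : 'F_p) == 0) = (p %| k)%N.
Proof. by rewrite -(dvdn_pcharf (pchar_Fp p_prime)). Qed.

Lemma twoFp_neq0 : (2%:R : 'F_p) != 0.
Proof. by rewrite natrFp_eq0; apply/negP => /dvdn_leq; have := halfp_gt0; lia. Qed.

Lemma halfFp_neq0 : (n%:R : 'F_p) != 0.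
Proof. by rewrite natrFp_eq0; apply/negP => /dvdn_leq; have := halfp_gt0; lia. Qed.

Lemma Fp_expf (x : 'F_p) : x != 0 -> x ^+ (2 * n) = 1.
Proof.
move=> x0; apply: (mulIf x0); rewrite mul1r -exprSr.
by have -> : (2 * n).+1 = p; [rewrite p_eq addn1|have := expf_card x; rewrite card_Fp].
Qed.

Lemma Fp_prim_root : exists h : 'F_p, (2 * n).-primitive_root h.
Proof.
have n0 : (0 < 2 * n)%N by rewrite muln_gt0 halfp_gt0.
have hr : has (2 * n).-primitive_root (enum [pred x : 'F_p | x != 0]).
  apply: has_prim_root; rewrite // ?enum_uniq //.
    by apply/allP => x; rewrite mem_enum inE => /Fp_expf h; apply/unity_rootP.
  have <- : #|predC1 (0 : 'F_p)| = (2 * n)%N.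
    by rewrite cardC1 card_Fp // [LHS]/= p_eq addn1.
  by rewrite -cardE; apply/eq_leq; apply: eq_card => x; rewrite !inE.
by case/hasP: hr => h _ hp; exists h.
Qed.

Lemma Fp_prim_root_exp {h x : 'F_p} : (2 * n).-primitive_root h -> x != 0 ->
  exists i : 'I_(2 * n), x = h ^+ i.
Proof. by move=> hp /Fp_expf /(prim_rootP hp)[i ->]; exists i. Qed.

(** Euler's criterion: if [x = h ^+ i] with [h] a primitive root, [x ^+ n = 1] forces [2n] to divide
    [i * n], so [i] is even. *)
Lemma nonzero_squareE (x : 'F_p) : nonzero_square x = (x ^+ n == 1).
Proof.
apply/andP/eqP => [[x0 /existsP[y /eqP xE]]|xn1].
  have y0 : y != 0 by apply: contraNneq x0 => y0; rewrite xE y0 expr0n.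
  by rewrite xE -exprM Fp_expf.
have x0 : x != 0.
  by apply: contra_eq_neq xn1 => ->; rewrite expr0n (gtn_eqF halfp_gt0) eq_sym oner_eq0.
split=> //; have [h hp] := Fp_prim_root.
have [i xE] := Fp_prim_root_exp hp x0.
move: xn1; rewrite xE -exprM => /eqP.
rewrite -(prim_order_dvd hp) dvdn_pmul2r ?halfp_gt0 // => /dvdnP[j ->].
by apply/existsP; exists (h ^+ j); rewrite exprM.
Qed.

Lemma quad_charFp (x : 'F_p) : (quad_char x)%:~R = x ^+ n :> 'F_p.
Proof.
rewrite /quad_char; case: eqP => [->|/eqP x0].
  by rewrite expr0n (gtn_eqF halfp_gt0).
rewrite nonzero_squareE; case: eqP => [->//|/eqP xn].
have : (x ^+ n) ^+ 2 == 1 by rewrite -exprM mulnC Fp_expf.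
by rewrite sqrf_eq1 (negPf xn) /= => /eqP ->; rewrite rmorphN1.
Qed.

Lemma quad_charP (x : 'F_p) :
  [\/ x = 0 /\ quad_char x = 0, x != 0 /\ quad_char x = 1 | x != 0 /\ quad_char x = -1].
Proof.
rewrite /quad_char; case: eqP => [->|/eqP x0]; first by constructor 1.
by case: ifP; [constructor 2|constructor 3].
Qed.

(* Reduction mod p is injective on {-1, 0, 1}, as p is odd. *)
Lemma quad_char_eq (a : int) (x : 'F_p) : a \in [:: 0; 1; -1] ->
  a%:~R = x ^+ n -> quad_char x = a.
Proof.
rewrite -quad_charFp !inE => /or3P ha /eqP.
have one0 := oner_neq0 'F_p; have two0 := twoFp_neq0.
have e2 : (1 + 1 : 'F_p) = 2%:R by [].
case: (quad_charP x) => [] [_ ->]; case: ha => /eqP -> //;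
 rewrite ?rmorphN1 ?rmorph0 ?rmorph1 ?(eq_sym 0) ?oppr_eq0 ?(negPf one0) //;
 rewrite ?(eq_sym (-1)) -?addr_eq0 ?opprK ?e2 ?(negPf two0) //.
Qed.

Lemma quad_char1 : quad_char (1 : 'F_p) = 1.
Proof. by apply: quad_char_eq; rewrite // expr1n. Qed.

Lemma quad_charM (x y : 'F_p) : quad_char (x * y) = quad_char x * quad_char y.
Proof.
apply: quad_char_eq; last by rewrite rmorphM /= !quad_charFp exprMn.
by case: (quad_charP x) => [] [_ ->]; case: (quad_charP y) => [] [_ ->].
Qed.

Lemma quad_char_sqr (x : 'F_p) : x != 0 -> quad_char x ^+ 2 = 1.
Proof. by case: (quad_charP x) => [] [] // => [->|_ -> _|_ -> _]; rewrite ?eqxx. Qed.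

Lemma quad_char_square (x : 'F_p) : nonzero_square x -> quad_char x = 1.
Proof. by move=> xs; rewrite /quad_char xs; case/andP: xs => /negPf ->. Qed.

Lemma quad_charN1 : odd n -> quad_char (-1 : 'F_p) = -1.
Proof. by move=> no; apply: quad_char_eq; rewrite // rmorphN1 -signr_odd no. Qed.

Lemma sum_squares (V : nmodType) (g : 'F_p) (F : 'F_p -> V) : n.-primitive_root g ->
  \sum_(x | nonzero_square x) F x = \sum_(i < n) F (g ^+ i).
Proof.
move=> gp.
have inj : {in 'I_n &, injective (fun i : 'I_n => g ^+ i)}.
  move=> i j _ _ /eqP; rewrite (eq_prim_root_expr gp) !modn_small // => /eqP.
  exact: val_inj.
rewrite -[RHS](big_imset F inj); apply: eq_bigl => x; rewrite nonzero_squareE.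
apply/eqP/imsetP => [/(prim_rootP gp)[i ->]|[i _ ->]]; first by exists i.
by rewrite exprAC (prim_expr_order gp) expr1n.
Qed.
End QuadChar.

(** * Determinants read off from a basis of eigenvectors *)

Lemma det_diagonalized (K : fieldType) (m : nat) (A S : 'M[K]_m) (d : 'I_m -> K) :
  \det S != 0 -> (forall i k, \sum_j A i j * S j k = S i k * d k) ->
  \det A = \prod_k d k.
Proof.
move=> S0 AS; apply: (mulIf S0); rewrite -det_mulmx mulrC.
have -> : A *m S = S *m diag_mx (\row_k d k).
  by apply/matrixP => i k; rewrite mul_mx_diag !mxE AS.
by rewrite det_mulmx det_diag; congr (_ * _); apply: eq_bigr => k _; rewrite mxE.
Qed.

Lemma det_neq0_left_inverse (K : fieldType) (m : nat) (c : K) (T S : 'M[K]_m) :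
  c != 0 -> T *m S = c%:M -> \det S != 0.
Proof.
move=> c0 TS; have : \det (T *m S) != 0 by rewrite TS det_scalar expf_neq0.
by rewrite det_mulmx mulf_eq0 negb_or => /andP[].
Qed.

Lemma sum_powers_unity_root (K : fieldType) (n : nat) (u : K) :
  u ^+ n = 1 -> u != 1 -> \sum_(i < n) u ^+ i = 0.
Proof.
move=> un u1; apply/eqP; have /eqP := subrX1 u n.
by rewrite un subrr eq_sym mulf_eq0 subr_eq0 (negPf u1).
Qed.

(** * The sums L(psi) over the squares, and det A_p *)

Section SquareSum.
Variables (p n : nat) (K : fieldType).
Hypotheses (p_prime : prime p) (p_eq : p = (2 * n + 1)%N).
Implicit Type F : 'F_p -> K.

(** Only the values of [F] on squares count, so [psi x ^+ k] may be used even at [k = 0], where it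
    does not vanish at 0. *)
Definition square_sum F : K :=
  \sum_(x : 'F_p | nonzero_square x) (quad_char (1 + x))%:~R * F x.

Lemma nonzero_squareM (x y : 'F_p) :
  nonzero_square y -> nonzero_square (y * x) = nonzero_square x.
Proof.
by rewrite !(nonzero_squareE p_prime p_eq) exprMn => /eqP ->; rewrite mul1r.
Qed.

Lemma nonzero_squareV (x : 'F_p) : nonzero_square x^-1 = nonzero_square x.
Proof. by rewrite !(nonzero_squareE p_prime p_eq) exprVn invr_eq1. Qed.

Lemma nonzero_square_neq0 (x : 'F_p) : nonzero_square x -> x != 0.
Proof. by case/andP. Qed.

Lemma sum_squaresV F :
  \sum_(x | nonzero_square x) F x = \sum_(x | nonzero_square x) F x^-1.
Proof.
rewrite (reindex_inj (@invr_inj 'F_p)) /=.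
by apply: eq_bigl => x; rewrite nonzero_squareV.
Qed.

Lemma quad_char_addV (x y : 'F_p) : nonzero_square x ->
  quad_char (y + x^-1) = quad_char (1 + y * x).
Proof.
move=> xs; have x0 := nonzero_square_neq0 xs.
have -> : 1 + y * x = x * (y + x^-1) by rewrite mulrDr mulfV // addrC mulrC.
by rewrite (quad_charM p_prime p_eq) (quad_char_square xs) mul1r.
Qed.

Lemma square_sumV F : square_sum (fun x => F x^-1) = square_sum F.
Proof.
rewrite [RHS]sum_squaresV; apply: eq_bigr => x xs.
by rewrite quad_char_addV // mul1r.
Qed.

Lemma square_sum_shift F (y : 'F_p) : nonzero_square y ->
  \sum_(x | nonzero_square x) (quad_char (y + x))%:~R * F x
    = square_sum (fun x => F (y * x)).
Proof.
move=> ys; have y0 := nonzero_square_neq0 ys.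
rewrite (reindex_inj (mulfI y0)) /=; apply: eq_big => x.
  by rewrite nonzero_squareM.
move=> xs; have -> : y + y * x = y * (1 + x) by rewrite mulrDr mulr1.
by rewrite (quad_charM p_prime p_eq) (quad_char_square ys) mul1r.
Qed.

Variable psi : 'F_p -> K.
Hypothesis psi_char : mult_char psi.

Lemma mult_charV x : psi x^-1 = (psi x)^-1.
Proof.
have [psi0 psi1 psiM] := psi_char.
have [->|x0] := eqVneq x 0; first by rewrite invr0 psi0 invr0.
by apply/esym/mulr1_eq; rewrite -psiM mulfV.
Qed.

Lemma mult_charX x i : psi (x ^+ i) = psi x ^+ i.
Proof.
have [psi0 psi1 psiM] := psi_char.
by elim: i => [|i IHi]; rewrite ?expr0 // !exprS psiM IHi.
Qed.

Variable g : 'F_p.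
Hypotheses (g_prim : n.-primitive_root g) (psig_prim : n.-primitive_root (psi g)).

Lemma square_charn (x : 'F_p) : nonzero_square x -> psi x ^+ n = 1.
Proof.
rewrite (nonzero_squareE p_prime p_eq) => /eqP xn.
by have [_ psi1 _] := psi_char; rewrite -mult_charX xn.
Qed.

(** A geometric sum of ratio [u = psi g ^+ k / psi g ^+ l], which is 1 exactly when k and l agree
    mod n. *)
Lemma sum_squares_char k l :
  \sum_(x | nonzero_square x) psi x ^+ k * psi x^-1 ^+ l
    = if k == l %[mod n] then n%:R else 0.
Proof.
rewrite (sum_squares p_prime p_eq _ g_prim) //.
have z0 : psi g != 0.
  apply: contra_eq_neq (prim_expr_order psig_prim) => ->.
  by rewrite expr0n (gtn_eqF (halfp_gt0 p_prime p_eq)) eq_sym oner_eq0.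
pose u := psi g ^+ k / psi g ^+ l.
rewrite (eq_bigr (fun i : 'I_n => u ^+ i)) => [|i _]; last first.
  by rewrite mult_charV mult_charX exprVn !(exprAC _ i) -exprVn -exprMn.
have u1 : (u == 1) = (k == l %[mod n]).
  rewrite -(eq_prim_root_expr psig_prim) -(inj_eq (mulIf (expf_neq0 l z0))).
  by rewrite mul1r divfK // expf_neq0.
rewrite -u1; case: ifP => [/eqP ->|/negbT uN1].
  by rewrite (eq_bigr (fun=> 1)) ?sumr_const ?card_ord // => i _; rewrite expr1n.
apply: sum_powers_unity_root => //.
rewrite /u exprMn exprVn (exprAC _ k n) (exprAC _ l n).
by rewrite (prim_expr_order psig_prim) !expr1n divr1.
Qed.

Hypothesis n_neq0 : n%:R != 0 :> K.

(** The columns [psi (s i) ^+ k] are eigenvectors: substituting [s i * x] for [x] factors out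
    [psi (s i) ^+ k]. Orthogonality makes them independent. *)
Lemma det_Ap (s : 'I_n -> 'F_p) : enumerates_squares s ->
  (\det (Ap s))%:~R = \prod_(k < n) square_sum (fun x => psi x ^+ k).
Proof.
case=> s_inj s_sq.
have sE (F : 'F_p -> K) : \sum_i F (s i) = \sum_(x | nonzero_square x) F x.
  have s_inj' : {in 'I_n &, injective s} by move=> i j _ _; apply: s_inj.
  rewrite -(big_imset F s_inj'); apply: eq_bigl => x.
  by apply/imsetP/idP => [[i _ ->]|/s_sq[i <-]]; [apply/s_sq; exists i|exists i].
rewrite -det_map_mx.
apply: (@det_diagonalized _ _ _ (\matrix_(i, k) psi (s i) ^+ k)).
  apply: (@det_neq0_left_inverse _ _ n%:R (\matrix_(k, i) psi (s i)^-1 ^+ k)) => //.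
  apply/matrixP => k l; rewrite !mxE.
  transitivity (\sum_i psi (s i) ^+ l * psi (s i)^-1 ^+ k).
    by apply: eq_bigr => i _; rewrite !mxE mulrC.
  rewrite (sE (fun x => psi x ^+ l * psi x^-1 ^+ k)) sum_squares_char !modn_small //.
  by rewrite eq_sym -(inj_eq val_inj) /=; case: eqP.
move=> i k; have is_sq : nonzero_square (s i) by apply/s_sq; exists i.
transitivity (\sum_j (quad_char (s i + s j))%:~R * psi (s j) ^+ k).
  by apply: eq_bigr => j _; rewrite !mxE.
rewrite (sE (fun x => (quad_char (s i + x))%:~R * psi x ^+ k)).
rewrite (square_sum_shift (fun x => psi x ^+ k)) // mxE /square_sum big_distrr /=.
have [_ _ psiM] := psi_char.
by apply: eq_bigr => x _; rewrite psiM exprMn mulrCA.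
Qed.
End SquareSum.

(** * The action of A_p on odd functions *)

(** An odd function vanishes at 1 and is determined by its values at g, ..., g^m; these are the
    coordinates. The subtracted term is phi(y + x^-1), for y = g^(i+1) and x = g^(j+1), with the
    inverse cleared. *)
Definition half_matrix (p : nat) (g : 'F_p) (m : nat) : 'M[int]_m :=
  \matrix_(i, j) (quad_char (g ^+ i.+1 + g ^+ j.+1)
                  - quad_char (1 + g ^+ i.+1 * g ^+ j.+1)).

Section HalfMatrix.
Variables (p n m : nat) (K : fieldType).
Hypotheses (p_prime : prime p) (p_eq : p = (2 * n + 1)%N) (n_eq : n = (2 * m + 1)%N).
Variable g : 'F_p.
Hypothesis g_prim : n.-primitive_root g.

Lemma square_expr i : nonzero_square (g ^+ i).
Proof.
by rewrite (nonzero_squareE p_prime p_eq) exprAC (prim_expr_order g_prim) expr1n.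
Qed.

(** As n = 2m + 1, the group of squares consists of 1 and the m pairs g^j, g^-j with 1 <= j <= m. *)
Lemma sum_squares_half (V : nmodType) (F : 'F_p -> V) :
  \sum_(x | nonzero_square x) F x
    = F 1 + \sum_(j < m) (F (g ^+ j.+1) + F (g ^+ j.+1)^-1).
Proof.
rewrite (sum_squares p_prime p_eq F g_prim) -(big_mkord xpredT (fun i => F (g ^+ i))).
rewrite n_eq addn1 big_nat_recl // expr0 mul2n -addnn big_mkord big_split_ord /=.
rewrite big_split; congr (_ + (_ + _)).
rewrite (reindex_inj rev_ord_inj); apply: eq_bigr => j _ /=; congr F.
apply/esym/mulr1_eq; rewrite -exprD -(prim_expr_order g_prim) n_eq; congr (_ ^+ _).
by have := ltn_ord j; lia.
Qed.

Variable psi : 'F_p -> K.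
Hypotheses (psi_char : mult_char psi) (psig_prim : n.-primitive_root (psi g)).
Hypotheses (two_neq0 : 2%:R != 0 :> K) (n_neq0 : n%:R != 0 :> K).

Let odd_part k x : K := psi x ^+ k - psi x^-1 ^+ k.

Let odd_partV k x : odd_part k x^-1 = - odd_part k x.
Proof. by rewrite /odd_part invrK opprB. Qed.

Let odd_part1 k : odd_part k 1 = 0.
Proof. by rewrite /odd_part invr1 subrr. Qed.

Lemma odd_part_orthogonal (k l : 'I_m) :
  \sum_(j < m) odd_part k.+1 (g ^+ j.+1) * odd_part l.+1 (g ^+ j.+1)
    = - n%:R *+ (k == l).
Proof.
(* A product of two odd functions is even and vanishes at 1, so twice the half sum is the sum over
   all squares. *)
apply: (mulIf two_neq0).
transitivity (\sum_(x | nonzero_square x) odd_part k.+1 x * odd_part l.+1 x).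
  rewrite sum_squares_half odd_part1 mul0r add0r mulr_natr mulr2n -big_split.
  by apply: eq_bigr => j _; rewrite !odd_partV mulrNN.
pose T a b := \sum_(x | nonzero_square x) psi x ^+ a * psi x^-1 ^+ b.
transitivity (T (k.+1 + l.+1)%N 0 + T 0 (k.+1 + l.+1)%N - T k.+1 l.+1 - T l.+1 k.+1).
  rewrite /T -big_split -!sumrB; apply: eq_bigr => x _ /=.
  by rewrite /odd_part !exprD !expr0; ring.
rewrite /T !(sum_squares_char p_prime p_eq psi_char g_prim psig_prim).
have := ltn_ord k; have := ltn_ord l => lm km.
(* Since 0 < (k+1) + (l+1) <= 2m < n, the first two sums vanish; each of the others is n if k = l
   and 0 otherwise. *)
rewrite !modn_small ?n_eq; try lia.
rewrite !eqSS -n_eq addnS (eq_sym _ (nat_of_ord k)) -(inj_eq val_inj) /=.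
by case: eqP => _ /=; rewrite ?mulr1n ?mulr0n; ring.
Qed.

(** The odd part of psi^(k+1) is an eigenvector, because psi^(k+1) and its inverse share the
    eigenvalue L(psi^(k+1)). *)
Lemma det_half_matrix :
  (\det (half_matrix g m))%:~R = \prod_(k < m) square_sum (fun x => psi x ^+ k.+1).
Proof.
rewrite -det_map_mx.
pose S : 'M[K]_m := \matrix_(j, k) odd_part k.+1 (g ^+ j.+1).
apply: (@det_diagonalized _ _ _ S).
  apply: (@det_neq0_left_inverse _ _ (- n%:R) S^T); first by rewrite oppr_eq0.
  apply/matrixP => k l; rewrite !mxE -odd_part_orthogonal.
  by apply: eq_bigr => j _; rewrite !mxE.
move=> i k; set y := g ^+ i.+1; have y_sq : nonzero_square y := square_expr _.
have [_ psi1 psiM] := psi_char.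
transitivity (\sum_(x | nonzero_square x) (quad_char (y + x))%:~R * odd_part k.+1 x).
  rewrite sum_squares_half odd_part1 mulr0 add0r.
  apply: eq_bigr => j _; rewrite !mxE odd_partV.
  rewrite (quad_char_addV p_prime p_eq) ?square_expr // rmorphB /= -/y.
  by ring.
rewrite (square_sum_shift p_prime p_eq) // mxE /odd_part.
rewrite mulrBl -[in X in _ = _ - X](square_sumV p_prime p_eq).
rewrite /square_sum !big_distrr -sumrB; apply: eq_bigr => x _ /=.
by rewrite invfM !psiM !exprMn; ring.
Qed.
End HalfMatrix.

(** * Primitive roots of unity *)

Lemma closed_prim_root_exists (K : closedFieldType) (N : nat) :
  N%:R != 0 :> K -> exists z : K, N.-primitive_root z.
Proof.
move=> N0; have N_gt0 : (0 < N)%N by case: N N0 => //; rewrite eqxx.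
pose q : {poly K} := 'X^N - 1; have [r Dq] := closed_field_poly_normal q.
rewrite (monicP _) ?monicXnsubC // scale1r in Dq.
have rN1 : all N.-unity_root r by apply/allP=> z; rewrite -root_prod_XsubC -Dq.
have sz_r : (N < (size r).+1)%N by rewrite -(size_prod_XsubC r id) -Dq size_XnsubC.
have [|z] := hasP (has_prim_root N_gt0 rN1 _ sz_r); last by exists z.
by rewrite -separable_prod_XsubC -Dq separable_Xn_sub_1.
Qed.

Lemma prim_root_half (K : fieldType) (N : nat) (z : K) :
  (2 * N).-primitive_root z -> z ^+ N = -1.
Proof.
move=> zp; have := prim_order_gt0 zp; rewrite muln_gt0 => /= N0.
have : (z ^+ N) ^+ 2 == 1 by rewrite -exprM mulnC (prim_expr_order zp).
rewrite sqrf_eq1 -(prim_order_dvd zp) => /orP[/dvdn_leq|/eqP//].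
by move=> /(_ N0); lia.
Qed.

(** * Multiplicative characters and Jacobi sums *)

Section Characters.
Variables (p n : nat).
Hypotheses (p_prime : prime p) (p_eq : p = (2 * n + 1)%N).

Lemma char_exp_nat (K : fieldType) (chi : 'F_p -> K) k x :
  char_exp chi k%:Z x = if x == 0 then 0 else chi x ^+ k.
Proof. by []. Qed.

Lemma mult_char_exp_nat (K : fieldType) (chi : 'F_p -> K) k :
  mult_char chi -> mult_char (char_exp chi k%:Z).
Proof.
case=> chi0 chi1 chiM; split; rewrite ?char_exp_nat ?eqxx ?oner_eq0 ?chi1 ?expr1n //.
move=> x y; rewrite !char_exp_nat mulf_eq0; case: eqP => _; first by rewrite mul0r.
by case: eqP => _; rewrite ?mulr0 //= chiM -exprMn.
Qed.

Lemma char_expNV (K : fieldType) (chi : 'F_p -> K) k x : mult_char chi ->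
  char_exp chi (- k%:Z) x = char_exp chi k%:Z x^-1.
Proof.
move=> chic; rewrite /char_exp invr_eq0; case: eqP => // _.
by rewrite (mult_charV chic) -exprnN -exprnP exprVn.
Qed.

Lemma square_sum_char_exp (K : fieldType) (chi : 'F_p -> K) k :
  square_sum (char_exp chi k%:Z) = square_sum (fun x => chi x ^+ k).
Proof.
apply: eq_bigr => x xs; rewrite char_exp_nat.
by rewrite (negPf (nonzero_square_neq0 xs)).
Qed.

(** The character sending [h] to a primitive 2n-th root of unity [w] is a power of [chi]. Hence [w]
    is a power of [chi h], whose order is then at least 2n. *)
Lemma char_generator_prim (K : closedFieldType) (chi : 'F_p -> K) (h : 'F_p) :
  (2 * n)%:R != 0 :> K -> char_generator chi -> (2 * n).-primitive_root h ->
  (2 * n).-primitive_root (chi h).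
Proof.
move=> n0 [chic chig] hp; have [w wp] := closed_prim_root_exists n0.
have [_ chi1 _] := chic.
have n_gt0 := prim_order_gt0 hp.
(* Discrete logarithm to base [h]; the default 0 is reached only at [x = 0]. *)
pose dlog x : nat := if [pick i : 'I_(2 * n) | x == h ^+ i] is Some i then i else 0%N.
have dlogE x : x != 0 -> h ^+ dlog x = x.
  move=> x0; rewrite /dlog; case: pickP => [i /eqP -> //|hn].
  by have [i xE] := Fp_prim_root_exp p_prime p_eq hp x0; move: (hn i); rewrite xE eqxx.
have wE i x : x != 0 -> h ^+ i = x -> w ^+ dlog x = w ^+ i.
  move=> x0 hi; apply/eqP; rewrite (eq_prim_root_expr wp) -(eq_prim_root_expr hp).
  by rewrite hi dlogE.
have h0 : h != 0.
  apply: contra_eq_neq (prim_expr_order hp) => ->.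
  by rewrite expr0n (gtn_eqF n_gt0) eq_sym oner_eq0.
have [] := chig (fun x => if x == 0 then 0 else w ^+ dlog x).
  split; first by rewrite eqxx.
    by rewrite oner_eq0 (wE 0%N) // oner_eq0.
  move=> x y; rewrite mulf_eq0; case: eqVneq => [_|x0] /=; first by rewrite mul0r.
  case: eqVneq => [_|y0] /=; first by rewrite mulr0.
  by rewrite -exprD; apply: wE; rewrite ?mulf_neq0 // exprD !dlogE.
move=> k /(_ h); rewrite /char_exp (negPf h0) (wE 1%N) // => wchi.
have chihn : chi h ^+ (2 * n) = 1.
  by rewrite -(mult_charX chic) (prim_expr_order hp).
have [m mp m_dvd] := prim_order_exists n_gt0 chihn.
suff <- : m = (2 * n)%N by [].
apply/eqP; rewrite eqn_dvd m_dvd (prim_order_dvd wp) -[w]expr1 wchi.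
by rewrite exprnP exprzAC -exprnP (prim_expr_order mp) exp1rz eqxx.
Qed.

(** Up to psi(-1), the substitutions x -> 1 + x and, in the second sum, x -> x^-1 turn both Jacobi
    sums into sums of phi(1 + x) psi(x), the second with the extra weight phi(x). The total weight 1
    + phi(x) is 2 on squares and 0 on nonsquares. *)
Lemma square_sum_jacobi (K : fieldType) (psi : 'F_p -> K) : mult_char psi ->
  2%:R * square_sum psi
    = psi (-1) * (jacobi_sum (phi K) psi + jacobi_sum (phi K) (fun x => psi x^-1)).
Proof.
move=> psic; have [psi0 psi1 psiM] := psic.
have psiN1 : psi (-1) * psi (-1) = 1 by rewrite -psiM mulrNN mul1r.
have JE (f : 'F_p -> K) : jacobi_sum (phi K) f = \sum_x phi K (1 + x) * f (- x).
  rewrite /jacobi_sum (reindex_inj (addrI 1)) /=.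
  by apply: eq_bigr => x _; rewrite opprD addrA subrr add0r.
have JVE : jacobi_sum (phi K) (fun x => psi x^-1)
    = psi (-1) * \sum_x phi K x * phi K (1 + x) * psi x.
  rewrite JE (reindex_inj (@invr_inj 'F_p)) /= big_distrr /=; apply: eq_bigr => x _.
  rewrite invrN invrK -(mulN1r x) psiM; have [->|x0] := eqVneq x 0.
    by rewrite psi0 !mulr0.
  have -> : 1 + x = x * (1 + x^-1) by rewrite mulrDr mulr1 mulfV // addrC.
  rewrite /phi (quad_charM p_prime p_eq) rmorphM /=.
  have q2 : (quad_char x)%:~R * (quad_char x)%:~R = 1 :> K.
    by rewrite -rmorphM /= -expr2 (quad_char_sqr x0).
  by rewrite -[LHS]mul1r -[X in X * _ = _]q2; ring.
rewrite JVE JE.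
transitivity (psi (-1) * psi (-1) * \sum_x (1 + phi K x) * phi K (1 + x) * psi x).
  rewrite psiN1 mul1r /square_sum big_distrr /= [RHS](bigID (@nonzero_square p)) /=.
  rewrite [X in _ = _ + X]big1 ?addr0 => [|x xns].
    apply: eq_bigr => x xs; rewrite /phi (quad_char_square xs); ring.
  have [->|x0] := eqVneq x 0; first by rewrite psi0 mulr0.
  by rewrite /phi {1}/quad_char (negPf x0) (negPf xns) rmorphN1 subrr !mul0r.
rewrite -mulrA; congr (_ * _); rewrite !mulr_sumr -big_split /=; apply: eq_bigr => x _.
by rewrite -[in RHS](mulN1r x) psiM; ring.
Qed.

(** For the trivial character both Jacobi sums are the sum of phi over x != 1. This is -phi(1),
    since phi is odd and so sums to 0. *)
Lemma square_sum_trivial (K : fieldType) : odd n -> 2%:R != 0 :> K ->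
  square_sum (fun _ : 'F_p => 1 : K) = -1.
Proof.
move=> n_odd two0; pose triv (x : 'F_p) : K := if x == 0 then 0 else 1.
have trivc : mult_char triv.
  split; rewrite /triv ?eqxx ?oner_eq0 // => x y; rewrite mulf_eq0.
  by do 2?case: eqP => _ /=; rewrite ?mul0r ?mulr0 ?mulr1.
have -> : square_sum (fun _ : 'F_p => 1 : K) = square_sum triv.
  by apply: eq_bigr => x /nonzero_square_neq0 /negPf; rewrite /triv => ->.
have sum_phi : \sum_(x : 'F_p) phi K x = 0.
  apply: (mulIf two0); rewrite mul0r mulr_natr mulr2n.
  rewrite [X in X + _](reindex_inj oppr_inj) -big_split big1 // => x _ /=.
  rewrite /phi -mulN1r (quad_charM p_prime p_eq) (quad_charN1 p_prime p_eq n_odd).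
  by rewrite mulN1r rmorphN addNr.
have J1 (f : 'F_p -> K) : f =1 triv -> jacobi_sum (phi K) f = -1.
  move=> fE; rewrite /jacobi_sum (bigD1 1) //= fE subrr /triv eqxx mulr0 add0r.
  move: sum_phi; rewrite (bigD1 1) //= {1}/phi (quad_char1 p_prime p_eq).
  move/eqP; rewrite addrC addr_eq0 => /eqP <-.
  by apply: eq_bigr => x x1; rewrite fE /triv subr_eq0 eq_sym (negPf x1) mulr1.
apply: (mulfI two0); rewrite square_sum_jacobi // !J1 //.
  by rewrite /triv oppr_eq0 oner_eq0; ring.
by move=> x; rewrite /triv invr_eq0.
Qed.
End Characters.

(** * R_p as an integer, and its square *)

(** The factors come from 2 L(psi) = psi(-1) (J(phi, psi) + J(phi, psi^-1)) at psi = chi^(k+1),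
    where chi(-1) = -1. *)
Definition Rp_int (p : nat) (g : 'F_p) (m : nat) : int :=
  \prod_(k < m) ((-1) ^+ k.+1 * 2%:R) * \det (half_matrix g m).

Lemma prim_root_sqr (K : fieldType) (N : nat) (z : K) : (0 < N)%N ->
  (2 * N).-primitive_root z -> N.-primitive_root (z ^+ 2).
Proof.
move=> N0 zp; have := dvdn_prim_root zp (dvdn_mull 2 (dvdnn N)).
by rewrite mulnK.
Qed.

Section ComplexSide.
Variables (p n m : nat) (K : numClosedFieldType).
Hypotheses (p_prime : prime p) (p_eq : p = (2 * n + 1)%N) (n_eq : n = (2 * m + 1)%N).
Variables (chi : 'F_p -> K) (h : 'F_p).
Hypotheses (chi_gen : char_generator chi) (h_prim : (2 * n).-primitive_root h).

Let n_gt0 : (0 < n)%N. Proof. by rewrite n_eq addn1. Qed.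
Let g := h ^+ 2.
Let g_prim : n.-primitive_root g := prim_root_sqr n_gt0 h_prim.
Let chic : mult_char chi := proj1 chi_gen.

Let chih_prim : (2 * n).-primitive_root (chi h).
Proof.
apply: (char_generator_prim p_prime p_eq) => //.
by rewrite pnatr_eq0 muln_eq0 -lt0n n_gt0.
Qed.

Let chig_prim : n.-primitive_root (chi g).
Proof. by rewrite (mult_charX chic) prim_root_sqr. Qed.

Let chiN1 : chi (-1) = -1.
Proof.
by rewrite -(prim_root_half h_prim) (mult_charX chic) (prim_root_half chih_prim).
Qed.

Let two0 : 2%:R != 0 :> K. Proof. by rewrite pnatr_eq0. Qed.
Let n0 : n%:R != 0 :> K. Proof. by rewrite pnatr_eq0 -lt0n. Qed.

Lemma Rp_intE : Rp chi = (Rp_int g m)%:~R.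
Proof.
pose J k := jacobi_sum (phi K) (char_exp chi k%:Z)
            + jacobi_sum (phi K) (char_exp chi (- k%:Z)).
(* Here p - 1 = 4m + 2, so 0 < 4k < p - 1 means 1 <= k <= m. *)
have -> : Rp chi = \prod_(k < m) J k.+1.
  rewrite /Rp big_ltn_cond ?(prime_gt0 p_prime) //= big_add1.
  rewrite -(big_mkord xpredT (J \o succn)).
  rewrite (@big_nat_widen _ _ _ 0 m p.-1) /=; last by rewrite [p in p.-1]p_eq; lia.
  by apply: eq_bigl => k; rewrite [in LHS]p_eq n_eq; lia.
rewrite /Rp_int rmorphM /=.
rewrite (det_half_matrix p_prime p_eq n_eq g_prim chic chig_prim two0 n0).
rewrite rmorph_prod -big_split; apply: eq_bigr => k _ /=.
have psic := mult_char_exp_nat k.+1 chic.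
rewrite -square_sum_char_exp rmorphM rmorphXn rmorphN1 -mulrA /=.
have -> : (2%:R : int)%:~R = 2%:R :> K by [].
rewrite (square_sum_jacobi p_prime p_eq psic) char_exp_nat oppr_eq0 oner_eq0 chiN1.
rewrite mulrA -exprMn mulrNN mulr1 expr1n mul1r; congr (_ + _).
by apply: eq_bigr => x _; rewrite (char_expNV _ _ chic).
Qed.

Lemma Rp_int_sqr (s : 'I_n -> 'F_p) : enumerates_squares s ->
  - 2 ^+ n.-1 * \det (Ap s) = Rp_int g m ^+ 2.
Proof.
move=> s_enum; apply: (@intr_inj K).
pose L k := square_sum (fun x => chi x ^+ k).
(* The exponents m + k + 1 and m - k add up to n, so the two characters are inverse to each other on
   squares. *)
have LN k : (k < m)%N -> L (m + k.+1)%N = L (m - k)%N.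
  move=> km; rewrite /L -(square_sumV p_prime p_eq) /=; apply: eq_bigr => x xs.
  congr (_ * _); rewrite (mult_charV chic) exprVn; apply: mulr1_eq.
  by rewrite -exprD -(square_charn p_prime p_eq chic xs) n_eq; congr (_ ^+ _); lia.
have L0 : L 0%N = -1.
  apply: (square_sum_trivial p_prime p_eq) => //.
  by rewrite n_eq mul2n addn1 /= odd_double.
have detA : (\det (Ap s))%:~R = - (\prod_(k < m) L k.+1) ^+ 2.
  rewrite (det_Ap p_prime p_eq chic g_prim chig_prim n0 s_enum).
  rewrite -(big_mkord xpredT L) n_eq addn1 big_nat_recl // mul2n -addnn big_mkord.
  rewrite big_split_ord /= L0.
  rewrite mulN1r expr2; congr (- (_ * _)); rewrite (reindex_inj rev_ord_inj).
  apply: eq_bigr => k _ /=; rewrite -addnS LN ?subKn //.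
  by have := ltn_ord k; lia.
rewrite rmorphM rmorphN /= rmorphXn detA mulrNN /Rp_int exprMn rmorphM.
rewrite !rmorphXn /= (det_half_matrix p_prime p_eq n_eq g_prim chic chig_prim two0 n0).
congr (_ * _); rewrite n_eq addn1 /= exprM rmorph_prod -prodrXl.
rewrite (eq_bigr (fun=> 2%:R ^+ 2)) ?prodr_const ?card_ord // => k _.
by rewrite rmorphM rmorphXn /= rmorphN1 exprMn sqrr_sign mul1r.
Qed.
End ComplexSide.

(** * Products of signs *)

Lemma big_split_parity (T : Type) (idx : T) (op : Monoid.com_law idx) (F : nat -> T) m :
  \big[op/idx]_(j < 2 * m + 1) F j
    = op (\big[op/idx]_(j < m.+1) F (2 * j)%N) (\big[op/idx]_(j < m) F (2 * j).+1).
Proof.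
elim: m => [|m IHm]; first by rewrite big_ord0 !big_ord_recr !big_ord0 Monoid.mulm1.
have -> : (2 * m.+1 + 1 = (2 * m + 1).+2)%N by lia.
rewrite [LHS]big_ord_recr [in LHS]big_ord_recr /= IHm; set E := \big[op/idx]_(j < m.+1) _.
rewrite big_ord_recr /= -/E; set O := \big[op/idx]_(j < m) _; rewrite big_ord_recr /= -/O.
have -> : ((2 * m + 1).+1 = 2 * m.+1)%N by lia.
rewrite addn1 -!Monoid.mulmA; congr (op _ _).
rewrite Monoid.mulmA; exact: Monoid.mulmC.
Qed.

Lemma prod_sum_signs (f : nat -> int) (N : nat) : (forall i, (i < N)%N -> f i ^+ 2 = 1) ->
  exists2 k, \prod_(i < N) f i = (-1) ^+ k & \sum_(i < N) f i = N%:Z - k.*2%:Z.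
Proof.
elim: N => [|N IHN] fsq; first by exists 0%N; rewrite ?big_ord0.
have [i iN|k Pk Sk] := IHN; first by rewrite fsq // ltnW.
have /eqP := fsq N (ltnSn N); rewrite sqrf_eq1 => /orP[] /eqP fN.
  by exists k; rewrite big_ord_recr /= ?Pk ?Sk fN ?mulr1 //; lia.
by exists k.+1; rewrite big_ord_recr /= ?Pk ?Sk fN ?mulrN1 ?exprS ?mulN1r //; lia.
Qed.

(** A zero sum forces exactly half of the 2c signs to be -1. *)
Lemma prod_balanced_signs (f : nat -> int) (c : nat) :
  (forall i, (i < c + c)%N -> f i ^+ 2 = 1) -> \sum_(i < c + c) f i = 0 ->
  \prod_(i < c + c) f i = (-1) ^+ c.
Proof. by case/prod_sum_signs => k -> -> ?; congr (_ ^+ _); lia. Qed.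

(* Consecutive partial products share all factors but one, so they cancel in pairs. *)
Lemma prod_partial_products (Q u : nat -> int) (c : nat) :
  (forall k, Q k.+1 = Q k * u k) -> (forall k, (k <= 2 * c)%N -> Q k ^+ 2 = 1) ->
  \prod_(k < 2 * c) Q k.+1 = \prod_(j < c) u (2 * j).+1.
Proof.
move=> QS; elim: c => [|c IHc] Qsq; first by rewrite !big_ord0.
rewrite (_ : 2 * c.+1 = (2 * c).+2)%N; last by lia.
rewrite 2!big_ord_recr big_ord_recr /= IHc => [|k k_le]; last by apply: Qsq; lia.
by rewrite (QS (2 * c).+1) -mulrA; congr (_ * _); rewrite mulrA -expr2 Qsq ?mul1r //; lia.
Qed.

Lemma prod_fold (f : nat -> int) (c : nat) :
  \prod_(j < c) - (f j * f (c + (c - j.+1))%N) = (-1) ^+ c * \prod_(j < c + c) f j.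
Proof.
rewrite big_split_ord /= [X in _ * (_ * X)](reindex_inj rev_ord_inj) /= -big_split.
rewrite -[X in (-1) ^+ X]card_ord -prodr_const -big_split.
by apply: eq_big => [j|j _] /=; rewrite ?mulN1r ?inE.
Qed.

(** * Sign functions behaving like t -> (t/p) for p = 4m + 3 *)

Section OddCharacter.
Variables (p n m : nat) (e : nat -> int).
Hypotheses (p_eq : p = (2 * n + 1)%N) (n_eq : n = (2 * m + 1)%N).
Hypotheses (eM : forall a b, e (a * b)%N = e a * e b)
  (e_sqr : forall a, (0 < a < p)%N -> e a ^+ 2 = 1)
  (e_sub : forall a, (a <= p)%N -> e (p - a)%N = - e a).

Let e2_sqr : e 2 ^+ 2 = 1.
Proof. by apply: e_sqr; lia. Qed.

Let e_even j : e (2 * j)%N = e 2 * e j.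
Proof. exact: eM. Qed.

Let e_odd j : (j < n)%N -> e (2 * j).+1 = - (e 2 * e (n - j)%N).
Proof. by move=> jn; rewrite -eM -e_sub; [congr e|]; lia. Qed.

(** The product of e(1), ..., e(n) is split in two ways: at m, and by parity, where 2j + 1 = p - 2(n
    - j) reduces odd arguments to doubles. Comparison leaves (-1)^(m+1) e(2)^(2m+1) = 1. *)
Lemma odd_char_two : e 2 = (-1) ^+ m.+1.
Proof.
have e0 j : (0 < j < p)%N -> e j != 0.
  by move=> /e_sqr; apply: contra_eq_neq => ->; rewrite expr0n eq_sym oner_eq0.
pose A := \prod_(j < m) e j.+1; pose B := \prod_(j < m.+1) e (m + j.+1)%N.
have AB0 : A * B != 0.
  by rewrite mulf_neq0 //; apply/prodf_neq0 => j _; apply: e0; have := ltn_ord j; lia.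
have split1 : \prod_(j < 2 * m + 1) e j.+1 = A * B.
  rewrite (_ : 2 * m + 1 = m + m.+1)%N; last by lia.
  by rewrite big_split_ord; congr (_ * _); apply: eq_bigr => j _ /=; rewrite addnS.
have split2 : \prod_(j < 2 * m + 1) e j.+1 = (- e 2) ^+ m.+1 * B * (e 2 ^+ m * A).
  rewrite (big_split_parity *%R (fun j => e j.+1)); congr (_ * _).
    rewrite /B (reindex_inj rev_ord_inj) /=.
    rewrite -[X in (- e 2) ^+ X]card_ord -prodr_const -big_split.
    apply: eq_bigr => j _; have := ltn_ord j => jm.
    by rewrite /= e_odd; [rewrite mulNr; congr (- (_ * e _))|]; lia.
  rewrite -[X in (e 2) ^+ X]card_ord -prodr_const -big_split.
  by apply: eq_bigr => j _; rewrite /= -e_even; congr e; lia.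
have e2_pow : e 2 ^+ m.+1 * e 2 ^+ m = e 2.
  by rewrite exprS -mulrA -exprD addnn -mul2n exprM e2_sqr expr1n mulr1.
have : (-1) ^+ m.+1 * e 2 = 1.
  apply: (mulIf AB0); rewrite mul1r -[in RHS]split1 split2 -[in LHS]e2_pow (exprNn (e 2)).
  by ring.
move/(congr1 (fun x => (-1) ^+ m.+1 * x)).
by rewrite mulrA -expr2 sqrr_sign mul1r mulr1.
Qed.

(** The same splittings of the sum give A + B = e(2) (A - B). As e(2) = (-1)^(m+1), this says B = 0
    for odd m and A = 0 for even m. *)
Lemma sum_odd_char_parity :
  if odd m then \sum_(j < m.+1) e (2 * j).+1 = 0 else \sum_(j < m) e (2 * j.+1)%N = 0.
Proof.
pose A := \sum_(j < m) e j.+1; pose B := \sum_(j < m.+1) e (m + j.+1)%N.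
have evens : \sum_(j < m) e (2 * j.+1)%N = e 2 * A.
  by rewrite mulr_sumr; apply: eq_bigr => j _; rewrite e_even.
have odds : \sum_(j < m.+1) e (2 * j).+1 = - (e 2 * B).
  rewrite mulr_sumr -sumrN [RHS](reindex_inj rev_ord_inj) /=.
  apply: eq_bigr => j _; have := ltn_ord j => jm.
  by rewrite e_odd; [congr (- (_ * e _))|]; lia.
have : A + B = - (e 2 * B) + e 2 * A.
  transitivity (\sum_(j < 2 * m + 1) e j.+1).
    rewrite (_ : 2 * m + 1 = m + m.+1)%N; last by lia.
    by rewrite big_split_ord; congr (_ + _); apply: eq_bigr => j _ /=; rewrite addnS.
  rewrite (big_split_parity +%R (fun j => e j.+1)) odds -evens; congr (_ + _).
  by apply: eq_bigr => j _; congr e; lia.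
rewrite odds evens odd_char_two -signr_odd /=.
by case: (odd m) => /=; rewrite ?expr0 ?expr1; lia.
Qed.

(** The product of the partial products [Q k] collapses to the [u i] with i of one parity. Their
    arguments run once through the t <= n of the parity of m, and half of these have sign -1. *)
Lemma prod_odd_char_fact : \prod_(k < m) e (2 * k.+1)`! = 1.
Proof.
(* This is e(2i + 1) e(2i + 2), the two factors e(2) having cancelled. *)
pose u i := - (e i.+1 * e (n - i)%N).
pose Q k := \prod_(i < k) u i.
have QS k : Q k.+1 = Q k * u k by rewrite /Q big_ord_recr.
have e1 : e 1 = 1.
  have := e2_sqr; have := eM 1 2; rewrite mul1n => /eqP.
  rewrite -subr_eq0 -{1}[e 2]mul1r -mulrBl mulf_eq0 => /orP[|/eqP ->].
    by rewrite subr_eq0 => /eqP <-.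
  by rewrite expr0n.
have QE k : (k <= m)%N -> e (2 * k)`! = Q k.
  elim: k => [|k IHk] km; first by rewrite muln0 fact0 e1 /Q big_ord0.
  rewrite (_ : 2 * k.+1 = (2 * k).+2)%N; last by lia.
  rewrite !factS !eM IHk ?(ltnW km) // QS e_odd; last by lia.
  rewrite (_ : (2 * k).+2 = 2 * k.+1)%N; last by lia.
  by rewrite e_even -[RHS]mulr1 -e2_sqr /u; ring.
have usq i : (i < n)%N -> u i ^+ 2 = 1.
  by move=> i_n; rewrite sqrrN exprMn !e_sqr //; lia.
have Qsq k : (k <= n)%N -> Q k ^+ 2 = 1.
  elim: k => [|k IHk] kn; first by rewrite /Q big_ord0 expr1n.
  by rewrite QS exprMn IHk ?usq ?mulr1 // ltnW.
have -> : \prod_(k < m) e (2 * k.+1)`! = \prod_(k < m) Q k.+1.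
  by apply: eq_bigr => k _; rewrite QE.
have := sum_odd_char_parity; have [c mE] : exists c, m = (odd m + 2 * c)%N.
  by exists m./2; rewrite mul2n odd_double_half.
case: ifP mE => /= _ mE.
  have -> : m.+1 = (c.+1 + c.+1)%N by lia.
  move=> /(prod_balanced_signs (f := fun j => e (2 * j).+1)) Pc.
  have -> : m = (2 * c).+1 by lia.
  rewrite big_ord_recl /= (@prod_partial_products (fun k => Q k.+1) (fun k => u k.+1));
    [| by move=> k; rewrite QS | by move=> k kc; apply: Qsq; lia].
  (* The unpaired factor [Q 1 = u 0] supplies the missing index 0. *)
  rewrite {1}/Q big_ord_recl big_ord0 mulr1 /=.
  transitivity (\prod_(j < c.+1) u (2 * j)%N).
    rewrite big_ord_recl /=; congr (_ * _).
    by apply: eq_bigr => j _; congr u; rewrite /bump /=; lia.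
  (* The target 1 is written as the square of (-1)^(c+1); one copy becomes the product of the
     balanced signs, the other the minus signs of the folding. *)
  rewrite -[RHS](sqrr_sign _ c.+1) expr2 -[X in _ * X]Pc => [|i ic]; last first.
    by apply: e_sqr; lia.
  rewrite -(prod_fold (fun j => e (2 * j).+1)).
  apply: eq_bigr => j _; rewrite /u; congr (- (_ * e _)).
  by have := ltn_ord j; lia.
have -> : m = (c + c)%N by lia.
move=> /(prod_balanced_signs (f := fun j => e (2 * j.+1)%N)) Pc.
rewrite addnn -mul2n (@prod_partial_products Q u) //; last first.
  by move=> k kc; apply: Qsq; lia.
rewrite -[RHS](sqrr_sign _ c) expr2 -[X in _ * X]Pc => [|i ic]; last first.
  by apply: e_sqr; lia.
rewrite -(prod_fold (fun j => e (2 * j.+1)%N)).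
apply: eq_bigr => j _; rewrite /u; congr (- (e _ * e _)); first by lia.
by have := ltn_ord j; lia.
Qed.
End OddCharacter.

(** * R_p modulo p *)

Section ReductionModP.
Variables (p n m : nat).
Hypotheses (p_prime : prime p) (p_eq : p = (2 * n + 1)%N) (n_eq : n = (2 * m + 1)%N).
Variable g : 'F_p.
Hypothesis g_prim : n.-primitive_root g.

Let two_half : 2%:R * n%:R = -1 :> 'F_p.
Proof.
apply/eqP; rewrite -addr_eq0 -natrM -[1]/(1%:R) -natrD -p_eq.
by rewrite (natrFp_eq0 p_prime) dvdnn.
Qed.

(** In ['F_p], phi(1 + x) is (1 + x)^n; after binomial expansion, orthogonality retains a single
    term. *)
Lemma square_sum_Fp k : (0 < k < n)%N ->
  2%:R * square_sum (fun x : 'F_p => x ^+ k) = - 'C(n, k)%:R.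
Proof.
move=> /andP[k0 kn].
have idc : mult_char (fun x : 'F_p => x) by [].
suff -> : square_sum (fun x : 'F_p => x ^+ k) = n%:R * 'C(n, k)%:R.
  by rewrite mulrA two_half mulN1r.
transitivity (\sum_(i < n.+1) 'C(n, i)%:R *
    \sum_(x : 'F_p | nonzero_square x) x ^+ (i + k) * x^-1 ^+ 0).
  under [RHS]eq_bigr => i _ do rewrite mulr_sumr.
  rewrite exchange_big /=; apply: eq_bigr => x _.
  rewrite (quad_charFp p_prime p_eq) exprDn mulr_suml; apply: eq_bigr => i _.
  by rewrite expr1n mul1r expr0 mulr1 exprD -mulr_natl mulrA.
under eq_bigr => i _ do
  rewrite (sum_squares_char p_prime p_eq idc g_prim g_prim).
(* For 0 <= i <= n and 0 < k < n, the exponent i + k is divisible by n only at i = n - k. *)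
have nk : (n - k < n.+1)%N by lia.
rewrite (bigD1 (Ordinal nk)) //= big1 ?addr0 => [|i]; last first.
  rewrite -(inj_eq val_inj) /= => ink; have i_lt := ltn_ord i.
  case: ifP; rewrite ?mulr0 // mod0n => /eqP ikn.
  by have := divn_eq (i + k) n; rewrite ikn; case: (_ %/ _)%N => [|[|d]]; nia.
by rewrite subnK 1?ltnW // modnn mod0n eqxx bin_sub 1?ltnW // mulrC.
Qed.

(** Modulo p, 2(n - i) = -(2i + 1). So 2^k [n ^_ k] is (-1)^k times the product of the first k odd
    numbers, and 2^k k! is that of the first k positive even ones. *)
Lemma ffact_half_Fp k : (k <= n)%N ->
  2%:R ^+ (2 * k) * k`!%:R * (n ^_ k)%:R = (-1) ^+ k * (2 * k)`!%:R :> 'F_p.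
Proof.
elim: k => [|k IHk] kn; first by rewrite muln0 !expr0 !mul1r.
rewrite ffactnSr (_ : 2 * k.+1 = (2 * k).+2)%N; last by lia.
rewrite !factS !natrM !exprS natrB; last exact: ltnW.
have -> : (2 * k).+2%:R = 2%:R * k.+1%:R :> 'F_p by rewrite -natrM; congr _%:R; lia.
have E : - (2 * k).+1%:R = 2%:R * (n%:R - k%:R) :> 'F_p.
  by rewrite mulrBr two_half -natrM -natr1 opprD addrC.
transitivity (2%:R * k.+1%:R * (2%:R * (n%:R - k%:R)) *
   (2%:R ^+ (2 * k) * k`!%:R * (n ^_ k)%:R) : 'F_p); first by ring.
by rewrite -E IHk 1?ltnW //; ring.
Qed.

Let e t := quad_char (t%:R : 'F_p).

Let eM a b : e (a * b)%N = e a * e b.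
Proof. by rewrite /e natrM (quad_charM p_prime p_eq). Qed.

Let e_sqr a : (0 < a < p)%N -> e a ^+ 2 = 1.
Proof.
move=> /andP[a0 ap]; apply: quad_char_sqr; rewrite (natrFp_eq0 p_prime).
by apply/negP => /(dvdn_leq a0); rewrite leqNgt ap.
Qed.

Let n_odd : odd n.
Proof. by rewrite n_eq mul2n addn1 /= odd_double. Qed.

Let quad_charN (x : 'F_p) : quad_char (- x) = - quad_char x.
Proof.
by rewrite -mulN1r (quad_charM p_prime p_eq) (quad_charN1 p_prime p_eq n_odd) mulN1r.
Qed.

Let e_sub a : (a <= p)%N -> e (p - a)%N = - e a.
Proof.
move=> ap; rewrite /e -quad_charN natrB //.
by have /eqP -> : (p%:R : 'F_p) == 0; rewrite ?(natrFp_eq0 p_prime) ?sub0r.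
Qed.

Let quad_charX (x : 'F_p) k : quad_char (x ^+ k) = quad_char x ^+ k.
Proof.
elim: k => [|k IHk]; first by rewrite (quad_char1 p_prime p_eq).
by rewrite !exprS (quad_charM p_prime p_eq) IHk.
Qed.

Let e_fact_sqr k : (k < p)%N -> e k`! ^+ 2 = 1.
Proof.
elim: k => [|k IHk] kp; first by apply: e_sqr; rewrite prime_gt1.
by rewrite factS eM exprMn e_sqr // mul1r IHk // ltnW.
Qed.

(** As [n ^_ k] is C(n, k) k!, the preceding identity relates C(n, k) and (-1)^k (2k)! by the square
    factor (2^k k!)^2. *)
Let e_bin k : (k <= m)%N -> e 'C(n, k) = (-1) ^+ k * e (2 * k)`!.
Proof.
move=> km; have kn : (k <= n)%N by lia.
have kp : (k < p)%N by lia.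
have two2 : e 2 ^+ 2 = 1 by apply: e_sqr; lia.
have := congr1 (@quad_char p) (ffact_half_Fp kn).
rewrite -bin_ffact natrM !(quad_charM p_prime p_eq) !quad_charX.
rewrite (quad_charN1 p_prime p_eq n_odd) -!/(e _) => <-.
by rewrite exprM two2 expr1n mul1r mulrCA -expr2 (e_fact_sqr kp) mulr1.
Qed.

(** Modulo p, [Rp_int g m] is the product of (-1)^(k-1) C(n, k) over 1 <= k <= m. Each factor has
    symbol -e((2k)!), so the product has symbol (-1)^m, which is also the symbol of -2. *)
Lemma legendre_Rp_int : legendre p (- 2 * Rp_int g m) = 1.
Proof.
have idc : mult_char (fun x : 'F_p => x) by [].
have two0 := twoFp_neq0 p_prime p_eq; have n0 := halfFp_neq0 p_prime p_eq.
have RE : (Rp_int g m)%:~R = \prod_(k < m) ((-1) ^+ k * 'C(n, k.+1)%:R) :> 'F_p.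
  rewrite /Rp_int rmorphM /=.
  rewrite (det_half_matrix p_prime p_eq n_eq g_prim idc g_prim two0 n0).
  rewrite rmorph_prod -big_split; apply: eq_bigr => k _ /=.
  have k_lt : (0 < k.+1 < n)%N by have := ltn_ord k; lia.
  rewrite rmorphM rmorphXn rmorphN1 /= -mulrA.
  have -> : 2%:R%:~R = 2%:R :> 'F_p by [].
  by rewrite (square_sum_Fp k_lt) exprS; ring.
rewrite /legendre rmorphM /= RE (quad_charM p_prime p_eq) rmorphN quad_charN.
have -> : quad_char (2%:~R : 'F_p) = (-1) ^+ m.+1.
  exact: (odd_char_two p_eq n_eq eM e_sqr e_sub).
have -> : quad_char (\prod_(k < m) ((-1) ^+ k * 'C(n, k.+1)%:R) : 'F_p)
    = \prod_(k < m) (- e (2 * k.+1)`!).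
  rewrite (big_morph _ (quad_charM p_prime p_eq) (quad_char1 p_prime p_eq)).
  apply: eq_bigr => k _; rewrite (quad_charM p_prime p_eq) quad_charX.
  rewrite (quad_charN1 p_prime p_eq n_odd) -/(e _) e_bin ?ltn_ord //.
  by rewrite mulrA -exprD addnS exprS exprD -expr2 sqrr_sign mulr1 mulN1r.
under eq_bigr => k _ do rewrite -mulN1r.
rewrite big_split prodr_const card_ord /=.
rewrite (prod_odd_char_fact p_eq n_eq eM e_sqr e_sub) mulr1.
by rewrite exprS mulN1r opprK -expr2 sqrr_sign.
Qed.
End ReductionModP.

Theorem corollary1 (R : realType) (p n : nat) (p_prime : prime p)
    (p_eq : p = (2 * n + 1)%N) (p_mod4 : p = 3 %[mod 4])
    (chi : 'F_p -> R[i]) (chi_gen : char_generator chi)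
    (s : 'I_n -> 'F_p) (s_enum : enumerates_squares s) :
  let D : int := - 2 ^+ n.-1 * \det (Ap s) in
  0 <= D /\
  exists r : int, r%:~R = Num.sqrt (D%:~R : R) /\
    exists delta : int,
      [/\ delta = 1 \/ delta = -1,
          legendre p (- 2 * delta * r) = 1
        & Rp chi = (delta * r)%:~R].
Proof.
have [m n_eq] : exists m, n = (2 * m + 1)%N.
  by exists n./2; move: p_mod4; rewrite p_eq; lia.
have [h h_prim] := Fp_prim_root p_prime p_eq.
pose N := Rp_int (h ^+ 2) m.
have g_prim := prim_root_sqr (halfp_gt0 p_prime p_eq) h_prim.
have legN : legendre p (- 2 * N) = 1 := legendre_Rp_int p_prime p_eq n_eq g_prim.
have DE := Rp_int_sqr p_prime p_eq n_eq chi_gen h_prim s_enum.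
have RE := Rp_intE p_prime p_eq n_eq chi_gen h_prim.
rewrite /= DE -/N; split; first exact: sqr_ge0.
(* Since D = N^2, the root is |N|, and [delta] is the sign of N. *)
exists `|N|; split; first by rewrite rmorphXn /= sqrtr_sqr intr_norm.
exists (if 0 <= N then 1 else -1).
rewrite RE -/N.
have NE : (if 0 <= N then 1 else -1) * `|N| = N.
  have [N0|N0] := lerP 0 N; first by rewrite (ger0_norm N0) mul1r.
  by rewrite (ltr0_norm N0) mulN1r opprK.
split; first by case: ifP; [left|right].
  by rewrite -mulrA NE.
by rewrite NE.
Qed.
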